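(* Let $(X,\Sigma,\mu)$ be a $\sigma$-finite complete measure space. Let $\Phi_1,\Phi_2$ be Young functions with $\Phi_1,\Phi_2\in\Delta_2$, and suppose there is a Young function $\Phi_3$ such that $\Phi_2(xy)\le \Phi_1(x)+\Phi_3(y)$ for all $x,y\ge 0$. If $u\in L^{\Phi_3}(\Sigma)$, then $u$ induces a bounded multiplication operator $M_u:L^{\Phi_1}(\Sigma)\to L^{\Phi_2}(\Sigma)$, $M_uf=u\cdot f$.
   Context: A Young function is a continuous convex function $\Phi:\mathbb{R}\to\mathbb{R}$ such that $\Phi(x)=0$ if and only if $x=0$, $\Phi(-x)=\Phi(x)$, $\lim_{x\to\infty}\Phi(x)/x=\infty$ and $\lim_{x\to\infty}\Phi(x)=\infty$. $\Phi\in\Delta_2$ means there are $k>0$ and $x_0\ge0$ with $\Phi(2x)\le k\Phi(x)$ for all $x\ge x_0$. $L^0(\Sigma)$ is the space of $\mu$-a.e. equivalence classes of scalar-valued $\Sigma$-measurable functions on $X$; $\Phi(f)$ means $\Phi(|f|)$. The Orlicz space is $L^{\Phi}(\Sigma)=\{f\in L^0(\Sigma): \exists k>0,\ \int_X\Phi(kf)\,d\mu<\infty\}$ with norm $\|f\|_\Phi=\inf\{k>0:\int_X\Phi(f/k)\,d\mu\le1\}$. *)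

(* Defs.v *)
From HB Require Import structures.
From mathcomp Require Import all_boot all_order all_algebra.
From mathcomp Require Import all_classical all_reals all_analysis.
From mathcomp Require Import measurable_realfun complex.

Set Implicit Arguments.
Unset Strict Implicit.
Unset Printing Implicit Defensive.
Import Order.TTheory GRing.Theory Num.Theory.
Import numFieldNormedType.Exports.
Local Open Scope classical_set_scope.
Local Open Scope ring_scope.
Local Open Scope quotient_scope.

(* "Scalar-valued" means R-valued or R[i]-valued: the theory is developed once
   over this interface, meant only for [real_scalars] and [complex_scalars]. *)
Record scalarField (R : realType) := ScalarField {
  scalar_fieldType : fieldType ;
  of_real : {rmorphism R -> scalar_fieldType} ;
  modulus : scalar_fieldType -> R ;
  modulus_ge0 : forall x, 0 <= modulus x ;
  modulus_real : forall r, modulus (of_real r) = `|r| ;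
  modulusM : forall x y, modulus (x * y) = modulus x * modulus y ;
  modulusD : forall x y, modulus (x + y) <= modulus x + modulus y ;
  scalar_measurable : set (set scalar_fieldType) ;
  scalar_measurable0 : scalar_measurable set0 ;
  scalar_measurableC : forall A, scalar_measurable A -> scalar_measurable (~` A) ;
  scalar_measurable_bigcup : forall F : (set scalar_fieldType)^nat,
    (forall i, scalar_measurable (F i)) -> scalar_measurable (\bigcup_i F i) ;
  measurable_modulus_preimage : forall B : set R,
    measurable B -> scalar_measurable (modulus @^-1` B) ;
  measurable_scalarD : forall d (T : measurableType d) (f g : T -> scalar_fieldType),
    (forall A, scalar_measurable A -> measurable (f @^-1` A)) ->
    (forall A, scalar_measurable A -> measurable (g @^-1` A)) ->
    forall A, scalar_measurable A -> measurable ((fun x => f x + g x) @^-1` A) ;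
  measurable_scalarM : forall d (T : measurableType d) (f g : T -> scalar_fieldType),
    (forall A, scalar_measurable A -> measurable (f @^-1` A)) ->
    (forall A, scalar_measurable A -> measurable (g @^-1` A)) ->
    forall A, scalar_measurable A -> measurable ((fun x => f x * g x) @^-1` A)
}.

Definition scalar (R : realType) (K : scalarField R) : Type :=
  GRing.Field.sort (scalar_fieldType K).
Coercion scalar : scalarField >-> Sortclass.

HB.instance Definition _ (R : realType) (K : scalarField R) :=
  GRing.Field.on (scalar K).
HB.instance Definition _ (R : realType) (K : scalarField R) :=
  isPointed.Build (scalar K) (0 : scalar K).
HB.instance Definition _ (R : realType) (K : scalarField R) :=
  @isMeasurable.Build default_measure_display (scalar K) (@scalar_measurable R K)
    (@scalar_measurable0 R K) (@scalar_measurableC R K)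
    (@scalar_measurable_bigcup R K).

Section real_scalars.
Variable R : realType.

Let preimageP d (T : measurableType d) (f : T -> R) :
  measurable_fun [set: T] f <-> forall A, measurable A -> measurable (f @^-1` A).
Proof.
by split=> [mf A mA|mf _ A mA]; [rewrite -[X in measurable X]setTI|rewrite setTI];
  exact: mf.
Qed.

Let real_modulus (B : set R) :
  measurable B -> measurable ((fun x : R => `|x|) @^-1` B).
Proof. by move: B; apply/preimageP; exact: measurableT_comp. Qed.

Let realD d (T : measurableType d) (f g : T -> R) :
  (forall A, measurable A -> measurable (f @^-1` A)) ->
  (forall A, measurable A -> measurable (g @^-1` A)) ->
  forall A, measurable A -> measurable ((fun x => f x + g x) @^-1` A).
Proof. by move=> /preimageP mf /preimageP mg; apply/preimageP; exact: measurable_funD. Qed.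

Let realM d (T : measurableType d) (f g : T -> R) :
  (forall A, measurable A -> measurable (f @^-1` A)) ->
  (forall A, measurable A -> measurable (g @^-1` A)) ->
  forall A, measurable A -> measurable ((fun x => f x * g x) @^-1` A).
Proof. by move=> /preimageP mf /preimageP mg; apply/preimageP; exact: measurable_funM. Qed.

Definition real_scalars : scalarField R :=
  @ScalarField R R idfun (fun x : R => `|x|) (@normr_ge0 _ _) (fun=> erefl)
    (@normrM _) (@ler_normD _ _) measurable measurable0 (@measurableC _ R)
    (@bigcupT_measurable _ R) real_modulus realD realM.

End real_scalars.

Section complex_scalars.
Variable R : realType.

Definition complex_of_pair (p : R * R) : R[i] := Complex p.1 p.2.

(* The Borel sets of R[i]: those of R^2, i.e. the product of the Borel
   sigma-algebra of R with itself, under (a, b) |-> a + i b. *)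
Definition measurable_complex : set (set R[i]) :=
  [set A | measurable (complex_of_pair @^-1` A)].

Let measurable_complex0 : measurable_complex set0.
Proof. by rewrite /measurable_complex/= preimage_set0. Qed.

Let measurable_complexC A : measurable_complex A -> measurable_complex (~` A).
Proof.
by move=> mA; rewrite /measurable_complex/= preimage_setC; exact: measurableC.
Qed.

Let measurable_complex_bigcup (F : (set R[i])^nat) :
  (forall i, measurable_complex (F i)) -> measurable_complex (\bigcup_i F i).
Proof.
by move=> mF; rewrite /measurable_complex/= preimage_bigcup;
  exact: bigcupT_measurable.
Qed.

Let complexP d (T : measurableType d) (f : T -> R[i]) :
  (forall A, measurable_complex A -> measurable (f @^-1` A)) <->
  measurable_fun [set: T] (fun x => complex.Re (f x)) /\
  measurable_fun [set: T] (fun x => complex.Im (f x)).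
Proof.
split=> [mf|[mr mi] A mA].
  split=> _ B mB; rewrite setTI.
  - apply: (mf (@complex.Re R @^-1` B)).
    have mfst : measurable_fun [set: R * R] (@fst R R) by [].
    by have := mfst measurableT B mB; rewrite setTI.
  - apply: (mf (@complex.Im R @^-1` B)).
    have msnd : measurable_fun [set: R * R] (@snd R R) by [].
    by have := msnd measurableT B mB; rewrite setTI.
have := measurable_fun_pair mr mi measurableT mA; rewrite setTI.
by congr measurable; apply/seteqP; split=> x /=; rewrite /complex_of_pair/=;
  case: (f x).
Qed.

Let complex_modulus (B : set R) :
  measurable B -> measurable_complex (@Normc.normc R @^-1` B).
Proof.
have : measurable_fun [set: R * R] (fun p => Num.sqrt (p.1 ^+ 2 + p.2 ^+ 2)).
  apply: (measurableT_comp (continuous_measurable_fun (@sqrt_continuous R))).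
  by apply: measurable_funD; apply: measurable_funX.
by move=> mn mB; have := mn measurableT B mB; rewrite setTI.
Qed.

Let complexD d (T : measurableType d) (f g : T -> R[i]) :
  (forall A, measurable_complex A -> measurable (f @^-1` A)) ->
  (forall A, measurable_complex A -> measurable (g @^-1` A)) ->
  forall A, measurable_complex A -> measurable ((fun x => f x + g x) @^-1` A).
Proof.
move=> /complexP[fr fi] /complexP[gr gi]; apply/complexP; split.
- rewrite (_ : (fun _ => _) = (fun x => complex.Re (f x) + complex.Re (g x))).
    exact: measurable_funD.
  by apply/funext => x; case: (f x) (g x) => [a b] [].
- rewrite (_ : (fun _ => _) = (fun x => complex.Im (f x) + complex.Im (g x))).
    exact: measurable_funD.
  by apply/funext => x; case: (f x) (g x) => [a b] [].
Qed.

Let complexM d (T : measurableType d) (f g : T -> R[i]) :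
  (forall A, measurable_complex A -> measurable (f @^-1` A)) ->
  (forall A, measurable_complex A -> measurable (g @^-1` A)) ->
  forall A, measurable_complex A -> measurable ((fun x => f x * g x) @^-1` A).
Proof.
move=> /complexP[fr fi] /complexP[gr gi]; apply/complexP; split.
- rewrite (_ : (fun _ => _) = (fun x => complex.Re (f x) * complex.Re (g x)
                                      - complex.Im (f x) * complex.Im (g x))).
    by apply: measurable_funB; exact: measurable_funM.
  by apply/funext => x; case: (f x) (g x) => [a b] [].
- rewrite (_ : (fun _ => _) = (fun x => complex.Re (f x) * complex.Im (g x)
                                      + complex.Im (f x) * complex.Re (g x))).
    by apply: measurable_funD; exact: measurable_funM.
  by apply/funext => x; case: (f x) (g x) => [a b] [].
Qed.

Let normc_ge0 (z : R[i]) : 0 <= Normc.normc z.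
Proof. by case: z => a b; exact: sqrtr_ge0. Qed.

Let normc_real (r : R) : Normc.normc (real_complex R r) = `|r|.
Proof. by rewrite /= expr0n/= addr0 sqrtr_sqr. Qed.

Definition complex_scalars : scalarField R :=
  @ScalarField R R[i] (real_complex R) (@Normc.normc R) normc_ge0 normc_real
    (@Normc.normcM R) (@le_normcD R) measurable_complex measurable_complex0
    measurable_complexC measurable_complex_bigcup complex_modulus complexD complexM.

End complex_scalars.

Section L0.
Context d (T : measurableType d) (R : realType).
Variables (mu : {measure set T -> \bar R}) (K : scalarField R).

Definition L0 : Type := {mfun_ mu, T >-> scalar K}.

HB.instance Definition _ := Choice.on L0.
HB.instance Definition _ := EqQuotient.on L0.

Definition L0_fun (f : L0) : T -> scalar K := repr f.
Coercion L0_fun : L0 >-> Funclass.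

Definition L0_class (f : T -> K) (mf : measurable_fun [set: T] f) : L0 :=
  \pi_L0 (mfun_Sub (mem_set mf : f \in mfun)).

Lemma L0_classE (f : T -> K) (mf : measurable_fun [set: T] f) :
  (L0_class mf : T -> K) = f %[ae mu].
Proof.
have /eqmodP/asboolP := reprK (L0_class mf).
exact.
Qed.

Lemma L0_eqP (f g : L0) : (f : T -> K) = g %[ae mu] -> f = g.
Proof.
move=> fg; rewrite -(reprK f) -(reprK g).
by apply/eqmodP/asboolP.
Qed.

Lemma measurable_L0 (f : L0) : measurable_fun [set: T] f.
Proof. exact: measurable_funPT. Qed.

Let preimageP (f : T -> K) :
  measurable_fun [set: T] f <-> forall A, measurable A -> measurable (f @^-1` A).
Proof.
by split=> [mf A mA|mf _ A mA]; [rewrite -[X in measurable X]setTI|rewrite setTI];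
  exact: mf.
Qed.

Let measurable_add (f g : L0) : measurable_fun [set: T] (fun x => f x + g x).
Proof.
by apply/preimageP; apply: measurable_scalarD; apply/preimageP; exact: measurable_L0.
Qed.

Lemma measurable_L0_mul (f g : L0) : measurable_fun [set: T] (fun x => f x * g x).
Proof.
by apply/preimageP; apply: measurable_scalarM; apply/preimageP; exact: measurable_L0.
Qed.

Let measurable_scale (a : K) (f : L0) : measurable_fun [set: T] (fun x => a * f x).
Proof.
apply/preimageP; apply: measurable_scalarM; last exact/preimageP/measurable_L0.
by apply/preimageP; exact: measurable_cst.
Qed.

Definition L0_zero : L0 := L0_class (measurable_cst (0 : K)).
Definition L0_add (f g : L0) : L0 := L0_class (measurable_add f g).
Definition L0_scale (a : K) (f : L0) : L0 := L0_class (measurable_scale a f).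
Definition L0_opp (f : L0) : L0 := L0_scale (- 1) f.
Definition L0_mul (f g : L0) : L0 := L0_class (measurable_L0_mul f g).

Let zeroE : (L0_zero : T -> K) = (fun=> 0) %[ae mu].
Proof. exact: L0_classE. Qed.
Let addE f g : (L0_add f g : T -> K) = (fun x => f x + g x) %[ae mu].
Proof. exact: L0_classE. Qed.
Let scaleE a f : (L0_scale a f : T -> K) = (fun x => a * f x) %[ae mu].
Proof. exact: L0_classE. Qed.

Let addA : associative L0_add.
Proof.
move=> f g h; apply: L0_eqP.
apply: filterS (filterI (filterI (addE f (L0_add g h)) (addE g h))
               (filterI (addE (L0_add f g) h) (addE f g))) => x [[e1 e2] [e3 e4]] _.
by rewrite e1// e2// e3// e4// addrA.
Qed.

Let addC : commutative L0_add.
Proof.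
move=> f g; apply: L0_eqP; move: (addE f g) (addE g f).
by apply: filterS2 => x e1 e2 _; rewrite e1// e2// addrC.
Qed.

Let add0 : left_id L0_zero L0_add.
Proof.
move=> f; apply: L0_eqP; move: (addE L0_zero f) zeroE.
by apply: filterS2 => x e1 e2 _; rewrite e1// e2// add0r.
Qed.

Let addN : left_inverse L0_zero L0_opp L0_add.
Proof.
move=> f; apply: L0_eqP; move: (addE (L0_opp f) f) zeroE (scaleE (- 1) f).
by apply: filterS3 => x e1 e2 e3 _; rewrite e1// e2// e3// mulN1r addNr.
Qed.

HB.instance Definition _ := GRing.isZmodule.Build L0 addA addC add0 addN.

Let scaleA a b (f : L0) : L0_scale a (L0_scale b f) = L0_scale (a * b) f.
Proof.
apply: L0_eqP.
move: (scaleE a (L0_scale b f)) (scaleE b f) (scaleE (a * b) f).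
by apply: filterS3 => x e1 e2 e3 _; rewrite e1// e2// e3// mulrA.
Qed.

Let scale1 : left_id 1 L0_scale.
Proof.
move=> f; apply: L0_eqP; move: (scaleE 1 f).
by apply: filterS => x e1 _; rewrite e1// mul1r.
Qed.

Let scaleDr : right_distributive L0_scale +%R.
Proof.
move=> a f g; apply: L0_eqP.
apply: filterS (filterI (filterI (scaleE a (L0_add f g)) (addE f g))
  (filterI (addE (L0_scale a f) (L0_scale a g))
           (filterI (scaleE a f) (scaleE a g)))) => x [[e1 e2] [e3 [e4 e5]]] _.
by rewrite [LHS]e1// e2// [RHS]e3// e4// e5// mulrDr.
Qed.

Let scaleDl (f : L0) : {morph L0_scale^~ f : a b / a + b}.
Proof.
move=> a b; apply: L0_eqP.
apply: filterS (filterI (scaleE (a + b) f)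
  (filterI (addE (L0_scale a f) (L0_scale b f))
           (filterI (scaleE a f) (scaleE b f)))) => x [e1 [e2 [e3 e4]]] _.
by rewrite [LHS]e1// [RHS]e2// e3// e4// mulrDl.
Qed.

HB.instance Definition _ := GRing.Zmodule_isLmodule.Build (scalar K) L0
  scaleA scale1 scaleDr scaleDl.

Lemma L0_0E : ((0 : L0) : T -> K) = (fun=> 0) %[ae mu].
Proof. exact: zeroE. Qed.

Lemma L0_DE (f g : L0) : ((f + g : L0) : T -> K) = (fun x => f x + g x) %[ae mu].
Proof. exact: addE. Qed.

Lemma L0_ZE (a : K) (f : L0) : ((a *: f : L0) : T -> K) = (fun x => a * f x) %[ae mu].
Proof. exact: scaleE. Qed.

Lemma L0_mulE (f g : L0) : (L0_mul f g : T -> K) = (fun x => f x * g x) %[ae mu].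
Proof. exact: L0_classE. Qed.

End L0.

Record youngFunction (R : realType) := YoungFunction {
  young_fun :> R -> R ;
  young_continuous : continuous young_fun ;
  young_convex : convex_function [set: R^o] young_fun ;
  young_eq0 : forall x, young_fun x = 0 <-> x = 0 ;
  young_even : forall x, young_fun (- x) = young_fun x ;
  young_superlinear : young_fun x / x @[x --> +oo] --> +oo ;
  young_cvgy : young_fun x @[x --> +oo] --> +oo
}.

Definition Delta2 (R : realType) (Phi : R -> R) :=
  exists k x0 : R, [/\ 0 < k, 0 <= x0 & forall x, x0 <= x -> Phi (2 * x) <= k * Phi x].

Section young_theory.
Variables (R : realType) (Phi : youngFunction R).

Lemma young0 : Phi 0 = 0.
Proof. exact/young_eq0. Qed.

Lemma young_conv (t x y : R) : 0 <= t -> t <= 1 ->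
  Phi (t * x + (1 - t) * y) <= t * Phi x + (1 - t) * Phi y.
Proof.
move=> t0 t1.
have := @young_convex _ Phi (Itv01 t0 t1) x y.
by rewrite !in_setT !convRE; apply.
Qed.

Lemma young_ge0 x : 0 <= Phi x.
Proof.
have h : (0 <= 2^-1 :> R) by rewrite invr_ge0.
have h1 : (2^-1 <= 1 :> R) by rewrite invf_le1// ler1n.
have e : (1 - 2^-1 = 2^-1 :> R) by rewrite {1}(splitr 1) div1r addrK.
have := young_conv x (- x) h h1.
rewrite e young_even mulrN subrr young0 -mulrDl -[X in X + _]div1r.
by rewrite -[X in _ + X]div1r -splitr mul1r.
Qed.

Lemma young_le x y : 0 <= x -> x <= y -> Phi x <= Phi y.
Proof.
move=> x0 xy; have [y0|y0] := eqVneq y 0.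
  by rewrite (_ : x = y)//; apply/eqP; rewrite eq_le xy y0.
have yp : 0 < y by rewrite lt_neqAle eq_sym y0 (le_trans x0).
have t0 : 0 <= x / y by rewrite divr_ge0// ltW.
have t1 : x / y <= 1 by rewrite ler_pdivrMr// mul1r.
have := young_conv y 0 t0 t1.
rewrite mulr0 addr0 young0 mulr0 addr0 divfK// => /le_trans; apply.
by rewrite ler_piMl// young_ge0.
Qed.

Lemma young_half x y : Phi (2^-1 * x + 2^-1 * y) <= Phi x + Phi y.
Proof.
have h : (0 <= 2^-1 :> R) by rewrite invr_ge0.
have h1 : (2^-1 <= 1 :> R) by rewrite invf_le1// ler1n.
have e : (1 - 2^-1 = 2^-1 :> R) by rewrite {1}(splitr 1) div1r addrK.
have := young_conv x y h h1; rewrite e => /le_trans; apply.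
by apply: lerD; rewrite ler_piMl// young_ge0.
Qed.

Lemma measurable_young : measurable_fun [set: R] Phi.
Proof. exact: continuous_measurable_fun (@young_continuous _ Phi). Qed.

End young_theory.

Section orlicz.
Context d (T : measurableType d) (R : realType).
Variables (mu : {measure set T -> \bar R}) (K : scalarField R).

(* \int Phi(f) dmu, where Phi(f) means Phi(|f|). *)
Definition young_integral (Phi : R -> R) (f : T -> K) : \bar R :=
  (\int[mu]_x (Phi (modulus (f x)))%:E)%E.

Section space.
Variable Phi : youngFunction R.

Definition orlicz : {pred L0 mu K} :=
  mem [set f : L0 mu K | exists2 k : R, 0 < k &
    (young_integral Phi (fun x => of_real K k * f x)%R < +oo)%E].

Record Orlicz := MkOrlicz { orlicz_val :> L0 mu K ; _ : orlicz_val \in orlicz }.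

HB.instance Definition _ := [isSub for orlicz_val].
HB.instance Definition _ := [Choice of Orlicz by <:].

(* For f in L^Phi the set is nonempty: Phi(c x) <= c Phi(x) for 0 <= c <= 1, so
   scaling down a k with finite integral makes the integral at most 1. *)
Definition orlicz_norm (f : Orlicz) : R :=
  inf [set k : R | 0 < k /\
    (young_integral Phi (fun x => f x / of_real K k)%R <= 1)%E].

Let measurable_modulus (f : T -> K) : measurable_fun [set: T] f ->
  measurable_fun [set: T] (fun x => modulus (f x)).
Proof.
move=> mf _ B mB.
exact: (mf measurableT _ (@measurable_modulus_preimage R K _ mB)).
Qed.

Lemma modulus_L0_measurable (f : L0 mu K) :
  measurable_fun [set: T] (fun x => modulus (f x)).
Proof. exact/measurable_modulus/measurable_L0. Qed.

Let measurable_integrand (k : R) (f : L0 mu K) :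
  measurable_fun [set: T] (fun x => (Phi (k * modulus (f x)))%:E).
Proof.
apply/measurable_EFinP; apply: (measurableT_comp (@measurable_young R Phi)).
by apply: measurable_funM => //; exact: modulus_L0_measurable.
Qed.

Let young_integral_scale (k : R) (f : L0 mu K) : 0 <= k ->
  young_integral Phi (fun x => of_real K k * f x) =
  (\int[mu]_x (Phi (k * modulus (f x)))%:E)%E.
Proof.
move=> k0; apply: eq_integral => x _.
by rewrite modulusM modulus_real ger0_norm.
Qed.

Let orlicz_linear (a : K) (f g : L0 mu K) :
  f \in orlicz -> g \in orlicz -> a *: f + g \in orlicz.
Proof.
rewrite !inE /= => -[k1 k10 f1] [k2 k20 g2].
pose b := modulus a + 1.
have bp : 0 < b by rewrite ltr_wpDl// modulus_ge0.
pose k := Num.min (2^-1 * (k1 / b)) (2^-1 * k2).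
have kp : 0 < k by rewrite lt_min !mulr_gt0// ?invr_gt0.
exists k => //.
rewrite young_integral_scale; last exact: ltW.
move: f1 g2; rewrite !young_integral_scale; try exact: ltW.
move=> f1 g2.
have fg : (\int[mu]_x ((Phi (k1 * modulus (f x)))%:E +
                       (Phi (k2 * modulus (g x)))%:E) < +oo)%E.
  rewrite ge0_integralD//; try exact: measurable_integrand.
  - exact: lte_add_pinfty.
  - by move=> x _; rewrite lee_fin young_ge0.
  - by move=> x _; rewrite lee_fin young_ge0.
apply: le_lt_trans fg.
apply: ae_ge0_le_integral => //.
- by move=> x _; rewrite lee_fin young_ge0.
- by move=> x _; rewrite -EFinD lee_fin addr_ge0// young_ge0.
- by apply: emeasurable_funD; exact: measurable_integrand.
move: (L0_DE (a *: f) g) (L0_ZE a f); apply: filterS2 => x e1 e2 _.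
rewrite e1// e2// -EFinD lee_fin (le_trans _ (young_half _ _ _))//.
apply: young_le; first by rewrite mulr_ge0 ?modulus_ge0// ltW.
have mf0 := modulus_ge0 (f x); have mg0 := modulus_ge0 (g x).
apply: (@le_trans _ _ (k * (modulus a * modulus (f x) + modulus (g x)))).
  by rewrite ler_pM2l// (le_trans (modulusD _ _))// modulusM.
rewrite mulrDr; apply: lerD; last first.
  by rewrite mulrA ler_wpM2r// ge_min lexx orbT.
apply: (@le_trans _ _ (k * (b * modulus (f x)))).
  by rewrite ler_pM2l// ler_wpM2r// lerDl.
rewrite mulrA [leRHS]mulrA ler_wpM2r// -ler_pdivlMr// -mulrA.
by rewrite ge_min lexx.
Qed.

Lemma orlicz_submod_closed : submod_closed orlicz.
Proof.
split; last exact: orlicz_linear.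
rewrite inE /=; exists 1 => //.
rewrite young_integral_scale//.
rewrite (_ : (\int[mu]_x _)%E = 0%E) ?ltry//.
transitivity (\int[mu]_x (cst 0%E x : \bar R))%E; last by rewrite integral0.
apply: ae_eq_integral => //.
move: (L0_0E mu K); apply: filterS => x e _ /=.
by rewrite e// -(rmorph0 (of_real K)) modulus_real normr0 mulr0 young0.
Qed.

HB.instance Definition _ := GRing.isSubmodClosed.Build (scalar K) (L0 mu K) orlicz
  orlicz_submod_closed.

HB.instance Definition _ := [SubChoice_isSubLmodule of Orlicz by <:].

End space.

Definition induces_bounded_multiplication (Phi1 Phi2 : youngFunction R)
    (u : L0 mu K) :=
  exists M : {linear Orlicz Phi1 -> Orlicz Phi2},
    (forall f, M f = L0_mul u f :> L0 mu K) /\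
    (exists2 C : R, 0 <= C &
      forall f, orlicz_norm (M f) <= C * orlicz_norm f).

End orlicz.

(* Main.v *)
From HB Require Import structures.
Require Import Defs.
From mathcomp Require Import all_boot all_order all_algebra.
From mathcomp Require Import all_classical all_reals all_analysis.
From mathcomp Require Import measurable_realfun.

Set Implicit Arguments.
Unset Strict Implicit.
Unset Printing Implicit Defensive.
Import Order.TTheory GRing.Theory Num.Theory.
Import numFieldNormedType.Exports.
Local Open Scope classical_set_scope.
Local Open Scope ring_scope.

(** Integrating the Young inequality gives
    [\int Phi2(|u f| / (m k)) <= \int Phi1(|f| / k) + \int Phi3(|u| / m)].
    If [k] and [m] are admissible in the Luxemburg norms of [f] and [u], the
    right-hand side is at most 2, hence by convexity [2 m k] is admissible in
    the norm of [u f]. Fixing one [m] and taking the infimum over [k] bounds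
    the operator by [2 m]. *)

Section modular.
Context d (T : measurableType d) (R : realType).
Context (mu : {measure set T -> \bar R}) (K : scalarField R).
Implicit Types (Phi : youngFunction R) (f g u : L0 mu K).

(** The scale is a real factor outside [modulus], so one formula serves both membership in [orlicz]
    (scale [k]) and the norm (scale [k^-1]), with no arithmetic in [K]. *)
Definition modular Phi (k : R) f : \bar R :=
  (\int[mu]_x (Phi (k * modulus (f x)))%:E)%E.

Lemma measurable_modular Phi k f :
  measurable_fun [set: T] (fun x => (Phi (k * modulus (f x)))%:E).
Proof.
apply/measurable_EFinP; apply: (measurableT_comp (measurable_young Phi)).
by apply: measurable_funM => //; exact: modulus_L0_measurable.
Qed.

Lemma modular_ge0 Phi k f : (0 <= modular Phi k f)%E.
Proof. by apply: integral_ge0 => x _; rewrite lee_fin young_ge0. Qed.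

Lemma young_integral_mul Phi (k : R) f : 0 < k ->
  young_integral mu Phi (fun x => of_real K k * f x) = modular Phi k f.
Proof.
move=> k0; apply: eq_integral => x _.
by rewrite modulusM modulus_real gtr0_norm.
Qed.

Lemma young_integral_div Phi (k : R) f : 0 < k ->
  young_integral mu Phi (fun x => f x / of_real K k) = modular Phi k^-1 f.
Proof.
move=> k0; rewrite -young_integral_mul ?invr_gt0//.
by apply: eq_integral => x _; rewrite fmorphV mulrC.
Qed.

(** Pointwise convexity between [k * modulus (f x)] and 0, where [Phi] vanishes. *)
Lemma modular_contract Phi (c k : R) f : 0 <= c -> c <= 1 ->
  (modular Phi (c * k) f <= c%:E * modular Phi k f)%E.
Proof.
move=> c0 c1; rewrite -ge0_integralZl_EFin//; last 2 first.
- by move=> x _; rewrite lee_fin young_ge0.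
- exact: measurable_modular.
apply: ge0_le_integral => //.
- by move=> x _; rewrite lee_fin young_ge0.
- exact: measurable_modular.
- by apply: measurable_funeM; exact: measurable_modular.
move=> x _; rewrite -EFinM lee_fin -mulrA.
have := young_conv Phi (k * modulus (f x)) 0 c0 c1.
by rewrite young0 !mulr0 !addr0.
Qed.

Lemma modular_mul (Phi1 Phi2 Phi3 : youngFunction R) (a b : R) u f :
  (forall x y : R, 0 <= x -> 0 <= y -> Phi2 (x * y) <= Phi1 x + Phi3 y) ->
  0 <= a -> 0 <= b ->
  (modular Phi2 (a * b) (L0_mul u f) <= modular Phi1 a f + modular Phi3 b u)%E.
Proof.
move=> Phi123 a0 b0.
rewrite -ge0_integralD//; try exact: measurable_modular;
  try by move=> x _; rewrite lee_fin young_ge0.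
apply: ae_ge0_le_integral => //.
- by move=> x _; rewrite lee_fin young_ge0.
- exact: measurable_modular.
- by move=> x _; rewrite -EFinD lee_fin addr_ge0// young_ge0.
- by apply: emeasurable_funD; exact: measurable_modular.
(* The representative of [L0_mul u f] is the pointwise product only almost everywhere. There [a] is
   grouped with [f] and [b] with [u], so that the hypothesis applies. *)
move: (L0_mulE u f); apply: filterS => x e _.
rewrite e// -EFinD lee_fin modulusM (mulrC (modulus _)) mulrACA.
by apply: Phi123; rewrite mulr_ge0 ?modulus_ge0.
Qed.

Lemma in_orlicz Phi f :
  f \in orlicz Phi <-> exists2 k : R, 0 < k & (modular Phi k f < +oo)%E.
Proof.
rewrite inE; split=> -[k k0 fk]; exists k => //.
  by rewrite -young_integral_mul.
by rewrite young_integral_mul.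
Qed.

Lemma orlicz_normE Phi (f : Orlicz mu K Phi) :
  orlicz_norm f = inf [set k : R | 0 < k /\ (modular Phi k^-1 f <= 1)%E].
Proof.
congr inf; apply/seteqP; split=> k /= [k0 fk]; split=> //.
  by rewrite -young_integral_div.
by rewrite young_integral_div.
Qed.

Lemma orlicz_norm_le Phi (f : Orlicz mu K Phi) (k : R) :
  0 < k -> (modular Phi k^-1 f <= 1)%E -> orlicz_norm f <= k.
Proof.
move=> k0 fk; rewrite orlicz_normE; apply: ge_inf => //.
by exists 0 => x /= [/ltW].
Qed.

(** Rules out the default value of [inf] on the empty set, and supplies the fixed scale for [u] in
    the operator bound. *)
Lemma orlicz_norm_set_nonempty Phi (f : Orlicz mu K Phi) :
  exists2 k : R, 0 < k & (modular Phi k^-1 f <= 1)%E.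
Proof.
have /in_orlicz[k k0 fk] := valP f.
have If : modular Phi k (val f) \is a fin_num.
  by rewrite ge0_fin_numE// modular_ge0.
pose I := fine (modular Phi k (val f)).
have I0 : 0 <= I by rewrite fine_ge0// modular_ge0.
have I1 : 0 < 1 + I by rewrite ltr_pwDl.
(* Contracting by [(1 + I)^-1] brings the modular down to at most [I / (1 + I)]; adding 1 also
   covers [I = 0]. *)
exists ((1 + I)^-1 * k)^-1; first by rewrite invr_gt0 mulr_gt0 ?invr_gt0.
rewrite invrK; apply: le_trans (modular_contract _ _ _ _ _) _.
- by rewrite invr_ge0 ltW.
- by rewrite invf_le1// lerDl.
rewrite -[X in (_ * X)%E](fineK If) -EFinM lee_fin -/I.
by rewrite ler_pdivrMl// mulr1 lerDr.
Qed.

Lemma L0_mul_linear u (a : K) f g :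
  L0_mul u (a *: f + g) = a *: L0_mul u f + L0_mul u g.
Proof.
apply: L0_eqP.
apply: filterS (filterI (filterI (L0_mulE u (a *: f + g)) (L0_DE (a *: f) g))
  (filterI (filterI (L0_ZE a f) (L0_DE (a *: L0_mul u f) (L0_mul u g)))
  (filterI (L0_ZE a (L0_mul u f)) (filterI (L0_mulE u f) (L0_mulE u g)))))
  => x [[e1 e2] [[e3 e4] [e5 [e6 e7]]]] _.
by rewrite e1// e2// e3// e4// e5// e6// e7// mulrDr mulrCA.
Qed.

Lemma young_inequality_multiplication (Phi1 Phi2 Phi3 : youngFunction R)
    (u : Orlicz mu K Phi3) :
  (forall x y : R, 0 <= x -> 0 <= y -> Phi2 (x * y) <= Phi1 x + Phi3 y) ->
  induces_bounded_multiplication Phi1 Phi2 u.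
Proof.
move=> Phi123.
have uf_orlicz (f : Orlicz mu K Phi1) : L0_mul u f \in orlicz Phi2.
  have /in_orlicz[k k0 fk] := valP f.
  have /in_orlicz[m m0 um] := valP u.
  apply/in_orlicz; exists (k * m); first exact: mulr_gt0.
  apply: le_lt_trans (modular_mul _ _ Phi123 (ltW k0) (ltW m0)) _.
  exact: lte_add_pinfty.
pose M (f : Orlicz mu K Phi1) : Orlicz mu K Phi2 := MkOrlicz (uf_orlicz f).
have M_linear : linear M.
  by move=> a f g; apply: val_inj; rewrite /= L0_mul_linear.
pose lM := GRing.isLinear.Build _ _ _ _ M M_linear.
pose ML : {linear Orlicz mu K Phi1 -> Orlicz mu K Phi2} := HB.pack M lM.
exists ML; split=> //.
(* [m] is chosen before [f], so the constant [2 * m] is uniform in [f]. *)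
have [m m0 um] := orlicz_norm_set_nonempty u.
exists (2 * m) => [|f]; first by rewrite mulr_ge0// ltW.
(* With the constant moved to the left, it suffices that the quotient is a lower bound of the
   admissible scales of [f]. *)
rewrite mulrC -ler_pdivrMr ?mulr_gt0// [leRHS]orlicz_normE.
apply: lb_le_inf.
  by have [k k0 fk] := orlicz_norm_set_nonempty f; exists k.
move=> k /= [k0 fk]; rewrite ler_pdivrMr ?mulr_gt0//.
apply: orlicz_norm_le; first by rewrite !mulr_gt0.
(* The factor [2^-1] is split off for [modular_contract], to absorb the bound 2 coming from the two
   modulars. *)
have -> : (k * (2 * m))^-1 = 2^-1 * (k^-1 * m^-1).
  by rewrite !invfM mulrCA.
apply: le_trans (modular_contract _ _ _ _ _) _.
- by rewrite invr_ge0.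
- by rewrite invf_le1// ler1n.
have uf2 : (modular Phi2 (k^-1 * m^-1) (M f) <= 2%:R%:E)%E.
  have ki : 0 <= k^-1 by rewrite invr_ge0 ltW.
  have mi : 0 <= m^-1 by rewrite invr_ge0 ltW.
  apply: le_trans (modular_mul _ _ Phi123 ki mi) _.
  by rewrite (natrD _ 1 1) EFinD leeD.
apply: le_trans (lee_wpmul2l _ uf2) _; first by rewrite lee_fin invr_ge0.
by rewrite -EFinM mulVf.
Qed.

End modular.

Theorem theorem2p2 (R : realType) (d : measure_display) (X : measurableType d)
    (mu : {measure set X -> \bar R}) (Phi1 Phi2 Phi3 : youngFunction R)
    (mu_sigma_finite : sigma_finite [set: X] mu)
    (mu_complete : measure_is_complete mu)
    (Phi1_Delta2 : Delta2 Phi1) (Phi2_Delta2 : Delta2 Phi2)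
    (Phi123 : forall x y : R, 0 <= x -> 0 <= y ->
      Phi2 (x * y) <= Phi1 x + Phi3 y) :
  (forall u : Orlicz mu (real_scalars R) Phi3,
    induces_bounded_multiplication Phi1 Phi2 u) /\
  (forall u : Orlicz mu (complex_scalars R) Phi3,
    induces_bounded_multiplication Phi1 Phi2 u).
Proof. by split=> u; exact: young_inequality_multiplication. Qed.
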